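(* Let $(\Gamma,\prec)$ be a planar graph and let $\prec_V$ be the linear order on its vertices given, for distinct vertices, by $v_1\prec_V v_2$ iff $v_1\to v_2$ or $\overline{o_{max}(v_1)}\prec\overline{i_{min}(v_2)}$. For any three vertices $v_1,v_2,v_3$, if $v_1\prec_V v_3\prec_V v_2$ and $v_1\to v_2$, then $v_1\to v_3$ or $v_3\to v_2$.
   Context: A graph is a triple $(H,P,\sigma)$ with $H$ a finite set (half-edges), $P$ a partition of $H$ into nonempty blocks (vertices), $\sigma$ an involution of $H$ (its orbits are the edges), such that a vertex containing a two-element $\sigma$-orbit equals that orbit. $\overline h$ denotes the edge containing the half-edge $h$. An orientation $\mathrm{sgn}:H\to\{+,-\}$ takes different values on the two elements of each two-element orbit; $In(v),Out(v)$ are the sets of half-edges in $v$ of sign $+$, $-$. The graph is directed if all $In(v),Out(v)$ are nonempty. The source (target) of an edge is the vertex containing its $-$ ($+$) half-edge, if there is one. A directed path is a sequence of edges $e_1,\dots,e_n$, $n\ge1$, with the target of $e_i$ equal to the source of $e_{i+1}$. For edges, $e\to e'$ means there is a directed path starting with $e$ and ending with $e'$; for vertices, $v\to v'$ means there is a directed path $e_1,\dots,e_n$ with $v$ the source of $e_1$ and $v'$ the target of $e_n$. A planar graph is a directed graph with a linear order $\prec$ on its set of edges such that for distinct edges: $(P_1)$ $e_1\to e_2$ implies $e_1\prec e_2$; $(P_2)$ if $e_1\to e_2$ and $e_1\prec e_3\prec e_2$, then $e_3\to e_2$ or $e_1\to e_3$. $In(v)$ and $Out(v)$ are linearly ordered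 by $\prec$ applied to the edges containing their elements; $i_{min}(v)=\min In(v)$ and $o_{max}(v)=\max Out(v)$. *)

(* Defs.v *)
From mathcomp Require Import all_boot.

Set Implicit Arguments.
Unset Strict Implicit.
Unset Printing Implicit Defensive.

Record graph := Graph {
  half_edge :> finType;
  blocks : {set {set half_edge}};
  sigma : half_edge -> half_edge;
  blocks_partition : partition blocks [set: half_edge];
  sigma_involutive : involutive sigma;
  loop_block : forall (v : {set half_edge}) (h : half_edge),
    v \in blocks -> sigma h != h -> [set h; sigma h] \subset v ->
    v = [set h; sigma h] }.

(* Since sigma is an involution, [set h; sigma h] is the sigma-orbit of h; it is
   a singleton exactly when h is a fixed point. *)
Definition orbits (G : graph) : {set {set G}} :=
  [set [set h; sigma h] | h in [set: G]].

Definition vertex (G : graph) := {v : {set G} | v \in blocks G}.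
Definition edge (G : graph) := {e : {set G} | e \in orbits G}.

Lemma orbit_in_orbits (G : graph) (h : G) : [set h; sigma h] \in orbits G.
Proof. exact: imset_f. Qed.

Definition edge_of (G : graph) (h : G) : edge G :=
  exist _ [set h; sigma h] (orbit_in_orbits h).

(* The sign + is true, the sign - is false. *)
Definition is_orientation (G : graph) (sgn : G -> bool) :=
  forall h : G, sigma h != h -> sgn (sigma h) != sgn h.

Definition half_in (G : graph) (sgn : G -> bool) (v : vertex G) : {set G} :=
  [set h in val v | sgn h].
Definition half_out (G : graph) (sgn : G -> bool) (v : vertex G) : {set G} :=
  [set h in val v | ~~ sgn h].

Record directed_graph := DirectedGraph {
  dgraph :> graph;
  sgn : dgraph -> bool;
  sgn_orientation : is_orientation sgn;
  in_nonempty : forall v : vertex dgraph, half_in sgn v != set0;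
  out_nonempty : forall v : vertex dgraph, half_out sgn v != set0 }.

Section Paths.
Variable G : directed_graph.

(* An edge has at most one source and at most one target, and may have none;
   hence relations rather than functions. *)
Definition is_source (e : edge G) (v : vertex G) : bool :=
  [exists h in val e, ~~ sgn h && (h \in val v)].
Definition is_target (e : edge G) (v : vertex G) : bool :=
  [exists h in val e, sgn h && (h \in val v)].

Definition consecutive : rel (edge G) :=
  fun e e' => [exists v : vertex G, is_target e v && is_source e' v].

(* The directed path e_1, ..., e_n is the nonempty sequence e :: s. *)
Definition directed_path (e : edge G) (s : seq (edge G)) : bool :=
  path consecutive e s.

Definition edge_reach (e e' : edge G) : Prop :=
  exists s : seq (edge G), directed_path e s /\ last e s = e'.

Definition vertex_reach (v v' : vertex G) : Prop :=
  exists (e : edge G) (s : seq (edge G)),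
    [/\ directed_path e s, is_source e v & is_target (last e s) v'].

End Paths.

Record planar_graph := PlanarGraph {
  pgraph :> directed_graph;
  prec : rel (edge pgraph);
  prec_irreflexive : irreflexive prec;
  prec_transitive : transitive prec;
  prec_total : forall e e' : edge pgraph, e != e' -> prec e e' || prec e' e;
  planar1 : forall e1 e2 : edge pgraph,
    e1 != e2 -> edge_reach e1 e2 -> prec e1 e2;
  planar2 : forall e1 e2 e3 : edge pgraph,
    e1 != e2 -> e1 != e3 -> e2 != e3 ->
    edge_reach e1 e2 -> prec e1 e3 -> prec e3 e2 ->
    edge_reach e3 e2 \/ edge_reach e1 e3 }.

Section VertexOrder.
Variable G : planar_graph.

Definition preceq : rel (edge G) := fun e e' => (e == e') || prec e e'.

Lemma in_inhabited (v : vertex G) : exists h : G, h \in half_in (@sgn G) v.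
Proof. exact/set0Pn/in_nonempty. Qed.

Lemma out_inhabited (v : vertex G) : exists h : G, h \in half_out (@sgn G) v.
Proof. exact/set0Pn/out_nonempty. Qed.

(* The xchoose term only witnesses nonemptiness: distinct half-edges of In(v)
   (of Out(v)) lie on distinct edges, so the extremum is unique. *)
Definition i_min (v : vertex G) : G :=
  extremum preceq (xchoose (in_inhabited v))
    (fun h => h \in half_in (@sgn G) v) (@edge_of G).
Definition o_max (v : vertex G) : G :=
  extremum (fun e e' => preceq e' e) (xchoose (out_inhabited v))
    (fun h => h \in half_out (@sgn G) v) (@edge_of G).

Definition precV (v1 v2 : vertex G) : Prop :=
  v1 <> v2 /\
  (vertex_reach v1 v2 \/ prec (edge_of (o_max v1)) (edge_of (i_min v2))).

End VertexOrder.

(* Main.v *)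
Require Import Defs.
From mathcomp Require Import all_boot.

(** Unless v1 -> v3 or v3 -> v2 already holds, the hypotheses on the vertex
    order say that o_max(v1) < i_min(v3) and o_max(v3) < i_min(v2).  Let
    e1, ..., en be a directed path from v1 to v2, f the edge of i_min(v3) and
    g the edge of o_max(v3).  Extremality of i_min and o_max gives
      e1 <= o_max(v1) < f <= g < i_min(v2) <= en,
    where f <= g because f enters v3 and g leaves it.  So f lies strictly
    between e1 and en, and (P_2) applied to e1 -> en yields e1 -> f or
    f -> en.  In the first case v1 -> v3, since f ends at v3.  In the second
    case the path from f to en has at least two edges; as f has no target
    other than v3, its second edge starts at v3, and hence v3 -> v2. *)

Section Directed.

Set Implicit Arguments.
Unset Strict Implicit.

Variable G : directed_graph.

Lemma edge_ofP (e : edge G) (h : G) :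
  h \in val e -> exists2 h0, e = edge_of h0 & h \in [set h0; sigma h0].
Proof.
case: e => e ee /= he; case/imsetP: (ee) => h0 _ e0.
by exists h0; [apply: val_inj | rewrite -e0].
Qed.

Lemma edge_of_mem (e : edge G) (h : G) : h \in val e -> e = edge_of h.
Proof.
case/edge_ofP => h0 -> /set2P[->|->] //.
by apply: val_inj; rewrite /= sigma_involutive setUC.
Qed.

Lemma sourceP (e : edge G) (v : vertex G) :
  reflect (exists2 h, h \in half_out (@sgn G) v & e = edge_of h)
    (is_source e v).
Proof.
apply: (iffP exists_inP) => [[h he /andP[nh hv]]|[h + ->]].
  by exists h; [rewrite inE hv | apply: edge_of_mem].
by rewrite inE => /andP[hv nh]; exists h; rewrite ?set21 ?nh.
Qed.

Lemma targetP (e : edge G) (v : vertex G) :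
  reflect (exists2 h, h \in half_in (@sgn G) v & e = edge_of h)
    (is_target e v).
Proof.
apply: (iffP exists_inP) => [[h he /andP[nh hv]]|[h + ->]].
  by exists h; [rewrite inE hv | apply: edge_of_mem].
by rewrite inE => /andP[hv nh]; exists h; rewrite ?set21 ?nh.
Qed.

Lemma vertex_eq (v w : vertex G) (h : G) :
  h \in val v -> h \in val w -> v = w.
Proof.
move=> hv hw; apply: val_inj.
have /and3P[_ triv _] := blocks_partition G.
by rewrite -(def_pblock triv (valP v) hv) (def_pblock triv (valP w) hw).
Qed.

(** The orientation differs on the two halves of an edge, so only one of them
    is positive, and that half-edge lies in a single block. *)
Lemma target_unique (e : edge G) (v w : vertex G) :
  is_target e v -> is_target e w -> v = w.
Proof.
case/exists_inP => h he /andP[sh hv] /exists_inP[k ke /andP[sk kw]].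
have {}ke : k \in [set h; sigma h] by rewrite (edge_of_mem he) in ke.
suff kh : k = h by apply: (vertex_eq hv); rewrite -kh.
case/set2P: ke => // kE; have [fix_h|/(sgn_orientation (d := G))] :=
  eqVneq (sigma h) h; first by rewrite kE.
by rewrite -kE sk sh.
Qed.

Lemma vertex_reach_to_target (e f : edge G) (v w : vertex G) :
  is_source e v -> edge_reach e f -> is_target f w -> vertex_reach v w.
Proof. by move=> ev [s [es <-]] fw; exists e, s. Qed.

(** Dropping f from the path leaves a path that starts at the target of f;
    distinctness of f and e makes it nonempty. *)
Lemma vertex_reach_from_target (f e : edge G) (w v : vertex G) :
  f != e -> is_target f w -> edge_reach f e -> is_target e v ->
  vertex_reach w v.
Proof.
move=> neq_fe fw [[|e' s] []] /=.
  by move=> _ eq_fe; rewrite eq_fe eqxx in neq_fe.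
move=> /andP[/existsP[u /andP[fu e'u]] ps] laste ev.
by exists e', s; rewrite laste (target_unique fw fu).
Qed.

End Directed.

Section Planar.

Set Implicit Arguments.
Unset Strict Implicit.

Variable G : planar_graph.

Lemma preceq_refl : reflexive (@preceq G).
Proof. by move=> e; rewrite /preceq eqxx. Qed.

Lemma preceq_trans : transitive (@preceq G).
Proof.
move=> b a c /predU1P[->//|ab] /predU1P[<-|bc]; rewrite /preceq.
  by rewrite ab orbT.
by rewrite (prec_transitive ab bc) orbT.
Qed.

Lemma preceq_total : total (@preceq G).
Proof.
move=> a b; rewrite /preceq; have [//|neq_ab] := eqVneq a b.
by case/orP: (prec_total neq_ab) => ->; rewrite ?orbT.
Qed.

Lemma preceq_prec_trans (b a c : edge G) : preceq a b -> prec b c -> prec a c.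
Proof. by case/predU1P => [->//|]; apply: prec_transitive. Qed.

Lemma prec_preceq_trans (b a c : edge G) : prec a b -> preceq b c -> prec a c.
Proof. by move=> ab /predU1P[<-//|]; apply: prec_transitive. Qed.

Lemma prec_neq (a b : edge G) : prec a b -> a != b.
Proof. by apply: contraTneq => ->; rewrite prec_irreflexive. Qed.

Lemma i_minP (v : vertex G) :
  is_target (edge_of (i_min v)) v /\
  forall e : edge G, is_target e v -> preceq (edge_of (i_min v)) e.
Proof.
rewrite /i_min; case: (@extremumP _ _ (@preceq G)) => /=.
- exact: preceq_refl.
- exact: preceq_trans.
- exact: preceq_total.
- exact: xchooseP (in_inhabited v).
move=> h hv hmin; split=> [|e /targetP[k kv ->]]; last exact: hmin.
by apply/targetP; exists h.
Qed.

Lemma o_maxP (v : vertex G) :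
  is_source (edge_of (o_max v)) v /\
  forall e : edge G, is_source e v -> preceq e (edge_of (o_max v)).
Proof.
rewrite /o_max; case: (@extremumP _ _ (fun e e' => @preceq G e' e)) => /=.
- exact: preceq_refl.
- by move=> b a c ba cb; apply: preceq_trans cb ba.
- by move=> a b; apply: preceq_total.
- exact: xchooseP (out_inhabited v).
move=> h hv hmax; split=> [|e /sourceP[k kv ->]]; last exact: hmax.
by apply/sourceP; exists h.
Qed.

(** The edge of i_min(v) followed by that of o_max(v) is a directed path; the
    two coincide exactly when v is the vertex of a loop. *)
Lemma i_min_preceq_o_max (v : vertex G) :
  preceq (edge_of (i_min v)) (edge_of (o_max v)).
Proof.
have [[tv _] [sv _]] := (i_minP v, o_maxP v).
rewrite /preceq; have [//|neq] := eqVneq; apply: planar1 neq _.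
exists [:: edge_of (o_max v)]; split=> //=.
by rewrite /directed_path /= andbT; apply/existsP; exists v; rewrite tv.
Qed.

End Planar.

Theorem proposition3p3p4 (G : planar_graph) (v1 v2 v3 : vertex G) :
  precV v1 v3 -> precV v3 v2 -> vertex_reach v1 v2 ->
  vertex_reach v1 v3 \/ vertex_reach v3 v2.
Proof.
move=> [_ [|lt13]]; first by left.
move=> [_ [|lt32]]; first by right.
move=> [e1 [s [path_s e1v1 env2]]].
set en := last e1 s in env2; set f := edge_of (i_min v3) in lt13.
have fv3 : is_target f v3 by case: (i_minP v3).
have e1f : prec e1 f by apply: preceq_prec_trans lt13; case: (o_maxP v1) => _ ->.
have fen : prec f en.
  apply: preceq_prec_trans (i_min_preceq_o_max v3) _.
  by apply: prec_preceq_trans lt32 _; case: (i_minP v2) => _ ->.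
have e1en := prec_transitive e1f fen.
have reach_en : edge_reach e1 en by exists s.
have enf : en != f by rewrite eq_sym prec_neq.
have [f_en|e1_f] :=
  planar2 (prec_neq e1en) (prec_neq e1f) enf reach_en e1f fen.
- by right; apply: vertex_reach_from_target (prec_neq fen) fv3 f_en env2.
- by left; apply: vertex_reach_to_target e1v1 e1_f fv3.
Qed.
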